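(* There are $\mathbb{C}$-operator spaces $X$ and $Y$ such that $X$ almost completely $\mathbb{C}$-isomorphically embeds into $Y$, but $X$ does not completely $\mathbb{R}$-isomorphically embed into $Y$.
   Context: A $\mathbb{C}$-operator space is a closed $\mathbb{C}$-linear subspace $X$ of $B(H)$ for a complex Hilbert space $H$; $M_n(X)$ carries the norm $\|\cdot\|_n$ inherited from $M_n(B(H))=B(H^n)$ ($H^n$ the $\ell_2$-direct sum of $n$ copies of $H$). For a map $f:X\to Y$ between operator spaces and $[x_{ij}]\in M_n(X)$, $f([x_{ij}])$ denotes $[f(x_{ij})]\in M_n(Y)$ (the $n$-th amplification of $f$). $X$ almost completely $\mathbb{C}$-isomorphically embeds into $Y$ if there are functions $\omega,\rho:[0,\infty)\to[0,\infty)$ with $\lim_{t\to\infty}\rho(t)=\infty$ and a sequence of $\mathbb{C}$-linear maps $(f^n:X\to Y)_{n\in\mathbb{N}}$ (here $n$ is an index, not a power) such that $$\rho(\|[x_{ij}]-[y_{ij}]\|_n)\le\|f^n([x_{ij}])-f^n([y_{ij}])\|_n\le\omega(\|[x_{ij}]-[y_{ij}]\|_n)$$ for all $n\in\mathbb{N}$ and all $[x_{ij}],[y_{ij}]\in M_n(X)$. $X$ completely $\mathbb{R}$-isomorphically embeds into $Y$ if there is an injective $\mathbb{R}$-linear map $u:X\to Y$ such that both $u$ and $u^{-1}:u(X)\to X$ are completely bounded, i.e. the operator norms of all their entrywise amplifications (between the matrix spaces $M_n(X)$ and $M_n(u(X))\subset M_n(Y)$) are bounded uniformly in $n$. *)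

(* Defs.v *)
From HB Require Import structures.
From mathcomp Require Import all_boot all_order all_algebra sesquilinear complex.
From mathcomp Require Import all_classical all_reals all_analysis.

Set Implicit Arguments.
Unset Strict Implicit.
Unset Printing Implicit Defensive.

Import Order.TTheory GRing.Theory Num.Theory.
Import numFieldNormedType.Exports.

Local Open Scope classical_set_scope.
Local Open Scope ring_scope.
Local Open Scope complex_scope.

(* The inner product is linear in its first argument and conjugate-linear in
   the second one. *)
Record hilbertType (R : realType) := HilbertType {
  hilbert_sort :> completeNormedModType R[i];
  hilbert_dot : {dot hilbert_sort for (@Num.conj R[i])};
  hilbert_normE : forall x : hilbert_sort, `|x| ^+ 2 = hilbert_dot x x
}.

(* The norm of a normed module over R[i] takes its values in R[i]; they are
   nonnegative, hence real, and [hnorm] reads them in R. *)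
Definition hnorm (R : realType) (H : hilbertType R) (h : H) : R :=
  complex.Re `|h|.

(* The operator norm, with values in [0, +oo], of a map f defined on the
   subset D of V, with respect to the norms nV and nW. *)
Definition opnorm (R : realType) (V W : Type) (nV : V -> R) (nW : W -> R)
    (D : set V) (f : V -> W) : \bar R :=
  ereal_sup [set (nW (f x))%:E | x in [set x | D x /\ nV x <= 1]].

Definition op_norm (R : realType) (H : hilbertType R) (T : H -> H) : \bar R :=
  opnorm (@hnorm R H) (@hnorm R H) setT T.

Definition bounded_operators (R : realType) (H : hilbertType R) :
    set (H -> H) :=
  [set T | linear T /\ (op_norm T < +oo)%E].
Arguments bounded_operators {R} H.

Record operator_space (R : realType) (H : hilbertType R) (X : set (H -> H)) :
    Prop := OperatorSpace {
  ospace_bounded : X `<=` bounded_operators H;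
  ospace_0 : X 0;
  ospace_linear : forall (a : R[i]) (S T : H -> H),
    X S -> X T -> X (a *: S + T);
  ospace_closed : forall T : H -> H, bounded_operators H T ->
    (forall e : R, 0 < e ->
       exists2 S : H -> H, X S & (op_norm (S - T)%R < e%:E)%E) ->
    X T
}.

Definition l2norm (R : realType) (H : hilbertType R) (n : nat)
    (h : 'I_n -> H) : R :=
  Num.sqrt (\sum_(i < n) hnorm (h i) ^+ 2).

Definition mx_action (R : realType) (H : hilbertType R) (n : nat)
    (T : 'M[H -> H]_n) (h : 'I_n -> H) : 'I_n -> H :=
  fun i => \sum_(j < n) T i j (h j).

(* The supremum is finite when the entries of T are bounded operators. *)
Definition mxnorm (R : realType) (H : hilbertType R) (n : nat)
    (T : 'M[H -> H]_n) : R :=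
  fine (opnorm (@l2norm R H n) (@l2norm R H n) setT (mx_action T)).

Definition mxspace (H : Type) (n : nat) (X : set (H -> H)) :
    set 'M[H -> H]_n :=
  [set T | forall i j, X (T i j)].

Definition C_linear_on (R : realType) (H K : hilbertType R)
    (X : set (H -> H)) (f : (H -> H) -> (K -> K)) : Prop :=
  forall (a : R[i]) (S T : H -> H), X S -> X T ->
    f (a *: S + T) = a *: f S + f T.

Definition R_linear_on (R : realType) (H K : hilbertType R)
    (X : set (H -> H)) (f : (H -> H) -> (K -> K)) : Prop :=
  forall (a : R) (S T : H -> H), X S -> X T ->
    f (a%:C *: S + T) = a%:C *: f S + f T.

Definition almost_completely_C_isomorphically_embeds (R : realType)
    (H K : hilbertType R) (X : set (H -> H)) (Y : set (K -> K)) : Prop :=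
  exists (omega rho : R -> R) (f : nat -> (H -> H) -> (K -> K)),
    [/\ forall t : R, 0 <= t -> 0 <= omega t /\ 0 <= rho t,
        rho t @[t --> +oo] --> +oo,
        forall n, (0 < n)%N -> set_fun X Y (f n) /\ C_linear_on X (f n) &
        forall n, (0 < n)%N -> forall x y : 'M[H -> H]_n,
          mxspace X x -> mxspace X y ->
          rho (mxnorm (x - y)) <= mxnorm (map_mx (f n) x - map_mx (f n) y)
            <= omega (mxnorm (x - y))].

Definition completely_bounded_on (R : realType) (H K : hilbertType R)
    (D : set (H -> H)) (f : (H -> H) -> (K -> K)) : Prop :=
  exists M : R, forall n, (0 < n)%N ->
    (opnorm (@mxnorm R H n) (@mxnorm R K n) (mxspace D) (map_mx f)
       <= M%:E)%E.

(* v stands for the inverse of u; its values outside u(X) are irrelevant. *)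
Definition completely_R_isomorphically_embeds (R : realType)
    (H K : hilbertType R) (X : set (H -> H)) (Y : set (K -> K)) : Prop :=
  exists (u : (H -> H) -> (K -> K)) (v : (K -> K) -> (H -> H)),
    [/\ set_fun X Y u, R_linear_on X u, {in X, cancel u v},
        completely_bounded_on X u & completely_bounded_on (u @` X) v].

(* Main.v *)
(* X is the column Hilbert space, realised as the operators x (x) e_0 on l2,
   and Y is the c0-sum over n of copies of the column space truncated at n:
   the n-th summand is indexed by the Bessel n-tuples v of l2, and x is sent to
   the columns (<x, v_m>)_{m < n}.  A matrix of M_n(X) applied to one vector of
   C^n only produces n vectors of l2, so by Gram-Schmidt some v sees them
   entirely: the map f^n is isometric on M_n(X).

   Let u be a complete embedding of X into Y, E_i the columns x = e_i, and y_i
   the image of E_i.  The row with entries E_0, ..., E_(k-1) has norm 1.  In a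
   block of size n, the squared norm of a column of operators is at most n
   times the squared norm of the row with the same entries; hence
   \sum_(i < k) ||y_i(t)||^2 <= n M^2 in each block t of size n, while
   ||y_i(t)|| tends to 0 as n grows.  By a gliding hump on the averages of the
   ||y_i(t)||^2, there are weights w_i of arbitrarily large sum such that
   \sum_i w_i ||y_i(t)||^2 <= 1 for all t.  Then the column with entries
   sqrt(w_i) y_i has norm at most 1, whereas the column with entries
   sqrt(w_i) E_i has squared norm \sum_i w_i, so that the inverse of u is not
   completely bounded. *)
From HB Require Import structures.
Require Import Defs.
From mathcomp Require Import all_boot all_order all_algebra sesquilinear.
From mathcomp Require Import complex finmap.
From mathcomp Require Import all_classical all_reals all_analysis.
From mathcomp Require Import ring lra.

Set Implicit Arguments.
Unset Strict Implicit.
Unset Printing Implicit Defensive.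

Import Order.TTheory GRing.Theory Num.Theory.
Import numFieldNormedType.Exports.

Local Open Scope classical_set_scope.
Local Open Scope ring_scope.
Local Open Scope complex_scope.

(** * The Hilbert space of square-summable families *)

Section SquaredModulus.
Variable R : realType.
Implicit Types z w : R[i].

Definition sqmod z : R := complex.Re z ^+ 2 + complex.Im z ^+ 2.

Lemma sqmod_ge0 z : 0 <= sqmod z.
Proof. by rewrite addr_ge0 ?sqr_ge0. Qed.

Lemma sqmodM z w : sqmod (z * w) = sqmod z * sqmod w.
Proof. by case: z w => a b [c d]; rewrite /sqmod /=; ring. Qed.

Lemma sqmodE z : (sqmod z)%:C = `|z| ^+ 2.
Proof. by rewrite add_Re2_Im2. Qed.

Lemma sqmod_real (a : R) : sqmod a%:C = a ^+ 2.
Proof. by rewrite /sqmod /= expr0n addr0. Qed.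

Lemma sqmod0 : sqmod 0 = 0.
Proof. by rewrite /sqmod /= expr0n addr0. Qed.

Lemma sqmod_conj z : sqmod z^*%C = sqmod z.
Proof. by case: z => a b; rewrite /sqmod /= sqrrN. Qed.

Lemma sqmod_eq0 z : sqmod z = 0 -> z = 0.
Proof.
move=> h; have := sqmodE z; rewrite h => /esym/eqP.
by rewrite sqrf_eq0 normr_eq0 => /eqP.
Qed.

Lemma sqmodD_le z w : sqmod (z + w) <= 2 * sqmod z + 2 * sqmod w.
Proof.
case: z w => a b [c d]; rewrite /sqmod /=.
by have := sqr_ge0 (a - c); have := sqr_ge0 (b - d); nra.
Qed.

(* Both sides are sums of nonnegative terms, so that the identity can be summed
   in the extended reals: this makes [rdot] below additive without any theory of
   signed sums. *)
Lemma sqmod_polar x y z :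
  sqmod (x + y + z) + sqmod x + sqmod y + sqmod z =
  sqmod (x + y) + sqmod (y + z) + sqmod (x + z).
Proof. by case: x y z => a b [c d] [e f]; rewrite /sqmod /=; ring. Qed.

(** Nothing is subtracted here either, so for [0 <= a] the identity can be summed in the extended
    reals; it yields the homogeneity of [rdot]. *)
Lemma sqmod_scale (a : R) z w :
  sqmod (a%:C * z + w) + a * sqmod z + a * sqmod w =
  a * sqmod (z + w) + a ^+ 2 * sqmod z + sqmod w.
Proof. by case: z w => b c [d e]; rewrite /sqmod /=; ring. Qed.

End SquaredModulus.

Lemma esumZl (R : realType) (I : choiceType) (c : R) (a : I -> \bar R) :
  0 <= c -> (forall i, 0 <= a i)%E ->
  (\esum_(i in [set: I]) (c%:E * a i) = c%:E * \esum_(i in [set: I]) a i)%E.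
Proof.
rewrite le_eqVlt => /predU1P[<-|c0] a0.
  by rewrite mul0e esum1// => i _; rewrite mul0e.
have leZ (d : R) (b : I -> \bar R) : 0 < d -> (forall i, 0 <= b i)%E ->
    (\esum_(i in [set: I]) (d%:E * b i) <= d%:E * \esum_(i in [set: I]) b i)%E.
  move=> d0 b0; apply: ge_ereal_sup => _ /= [X finX <-].
  rewrite -ge0_mule_fsumr//; rewrite lee_pmul2l//; apply: ereal_sup_ubound.
  by exists X.
(* The reverse inequality is [leZ] with the constant [c^-1], applied to the family [c * a i]. *)
apply/eqP; rewrite eq_le leZ//=.
rewrite -(@lee_pmul2l _ (c^-1)%:E) ?lte_fin ?invr_gt0//.
rewrite muleA -EFinM mulVf ?gt_eqF// mul1e.
apply: le_trans (leZ _ _ _ _); rewrite ?invr_gt0//; last first.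
  by move=> i; rewrite mule_ge0// lee_fin ltW.
apply: le_esum => i _.
by rewrite muleA -EFinM mulVf ?gt_eqF// mul1e.
Qed.

Ltac esum_pos :=
  solve [move=> *; rewrite -?EFinM -?EFinD ?lee_fin;
  repeat first [done | exact: sqmod_ge0 | exact: sqr_ge0
               | apply: addr_ge0 | apply: mulr_ge0]].

Section SquareSummable.
Variables (R : realType) (I : choiceType).
Implicit Types x y z : I -> R[i].

Definition sqsum x : \bar R := \esum_(i in [set: I]) (sqmod (x i))%:E.

Lemma sqsum_ge0 x : (0 <= sqsum x)%E.
Proof. by apply: esum_ge0 => i _; rewrite lee_fin sqmod_ge0. Qed.

Lemma sqsum_lin2 (a b : R) (x y : I -> R[i]) : 0 <= a -> 0 <= b ->
  (\esum_(i in [set: I]) (a * sqmod (x i) + b * sqmod (y i))%:E =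
   a%:E * sqsum x + b%:E * sqsum y)%E.
Proof.
move=> a0 b0; rewrite -!esumZl //; try by move=> i; rewrite lee_fin sqmod_ge0.
rewrite -esumD.
- by apply: eq_esum => i _; rewrite EFinD !EFinM.
- by move=> i _; rewrite -EFinM lee_fin mulr_ge0 ?sqmod_ge0.
- by move=> i _; rewrite -EFinM lee_fin mulr_ge0 ?sqmod_ge0.
Qed.

Lemma sqsumZ (c : R[i]) x : sqsum (c *: x) = ((sqmod c)%:E * sqsum x)%E.
Proof.
rewrite -esumZl ?sqmod_ge0//; last by move=> i; rewrite lee_fin sqmod_ge0.
by apply: eq_esum => i _; rewrite -EFinM -sqmodM.
Qed.

Definition square_summable : {pred I -> R[i]} :=
  fun x => `[< (sqsum x < +oo)%E >].

Lemma square_summableP x : reflect (sqsum x < +oo)%E (x \in square_summable).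
Proof. exact: asboolP. Qed.

Lemma square_summable_submod : submod_closed square_summable.
Proof.
split=> [|c x y /square_summableP x2 /square_summableP y2]; apply/square_summableP.
  by rewrite /sqsum esum1 ?ltry// => i _; rewrite sqmod0.
apply: (@le_lt_trans _ _ (2%:E * sqsum (c *: x) + 2%:E * sqsum y)%E).
  rewrite -sqsum_lin2//; apply: le_esum => i _; rewrite lee_fin.
  exact: sqmodD_le.
rewrite lte_add_pinfty// ?lte_mul_pinfty//.
by rewrite sqsumZ ?lte_mul_pinfty// lee_fin sqmod_ge0.
Qed.

HB.instance Definition _ := GRing.isSubmodClosed.Build R[i] (I -> R[i])
  square_summable square_summable_submod.

Record l2 := L2 { l2val :> I -> R[i]; l2P : l2val \in square_summable }.
HB.instance Definition _ := [isSub for l2val].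
HB.instance Definition _ := [Choice of l2 by <:].
HB.instance Definition _ := [SubChoice_isSubLmodule of l2 by <:].

End SquareSummable.

Section L2Norm.
Variables (R : realType) (I : choiceType).
Implicit Types x y z : l2 R I.

Definition nsq x : R := fine (sqsum x).

Lemma nsqE x : (nsq x)%:E = sqsum x.
Proof.
by rewrite fineK// ge0_fin_numE ?sqsum_ge0//; exact/square_summableP/(l2P x).
Qed.

Lemma nsq_ge0 x : 0 <= nsq x.
Proof. by rewrite -lee_fin nsqE sqsum_ge0. Qed.

Lemma nsqZ (c : R[i]) x : nsq (c *: x) = sqmod c * nsq x.
Proof. by apply: EFin_inj; rewrite EFinM !nsqE -sqsumZ. Qed.

Lemma nsq0 : nsq 0 = 0.
Proof. by rewrite -(scale0r 0) nsqZ sqmod0 mul0r. Qed.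

Lemma nsq_polar x y z :
  nsq (x + y + z) + nsq x + nsq y + nsq z =
  nsq (x + y) + nsq (y + z) + nsq (x + z).
Proof.
apply: EFin_inj; rewrite !EFinD !nsqE -!esumD//;
  try esum_pos.
by apply: eq_esum => i _; rewrite -!EFinD sqmod_polar.
Qed.

Lemma nsq_scale (a : R) x y : 0 <= a ->
  nsq (a%:C *: x + y) + a * nsq x + a * nsq y =
  a * nsq (x + y) + a ^+ 2 * nsq x + nsq y.
Proof.
move=> a0; apply: EFin_inj; rewrite -[nsq (a%:C *: x + y)]mul1r -[nsq y in RHS]mul1r.
rewrite !EFinD !EFinM !nsqE.
rewrite -!esumZl ?sqr_ge0//; try by move=> i; rewrite lee_fin sqmod_ge0.
rewrite -!esumD;
  try esum_pos.
apply: eq_esum => i _; rewrite -!EFinM -!EFinD !mul1r.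
by rewrite -sqmod_scale.
Qed.

Lemma sqmod_le_nsq x i : sqmod (x i) <= nsq x.
Proof.
rewrite -lee_fin nsqE.
rewrite -(@esum_set1 R I i (fun i => (sqmod (x i))%:E)) ?lee_fin ?sqmod_ge0//.
by apply: ereal_sup_le; apply: image_subset => A [? ?]; split.
Qed.

Lemma nsq_eq0 x : nsq x = 0 -> x = 0.
Proof.
move=> x0; apply/val_inj/funext => i; apply: sqmod_eq0.
by apply/eqP; rewrite eq_le sqmod_ge0 andbT -x0 sqmod_le_nsq.
Qed.

(** The real part of the inner product, obtained by polarization so that no series of signed or
    complex terms has to be summed. *)
Definition rdot x y : R := (nsq (x + y) - nsq x - nsq y) / 2.

Lemma rdotC x y : rdot x y = rdot y x.
Proof. by rewrite /rdot (addrC x) addrAC. Qed.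

Lemma rdotDl x y z : rdot (x + y) z = rdot x z + rdot y z.
Proof. by rewrite /rdot; have := nsq_polar x y z; lra. Qed.

Lemma rdot0l x : rdot 0 x = 0.
Proof. by rewrite /rdot add0r nsq0; lra. Qed.

Lemma rdotNl x y : rdot (- x) y = - rdot x y.
Proof. by have := rdotDl (- x) x y; rewrite addNr rdot0l; lra. Qed.

Lemma rdotZl (a : R) x y : rdot (a%:C *: x) y = a * rdot x y.
Proof.
(* [nsq_scale] covers nonnegative scalars only; negative ones follow from [rdotNl]. *)
wlog a0 : a / 0 <= a => [hwlog|].
  have [a0|a0] := leP 0 a; first exact: hwlog.
  have na0 : 0 <= - a by rewrite oppr_ge0 ltW.
  by have := hwlog _ na0; rewrite rmorphN scaleNr rdotNl mulNr => /oppr_inj.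
rewrite /rdot nsqZ sqmod_real; have := nsq_scale x y a0; lra.
Qed.

Lemma rdot_ii x y : rdot ('i *: x) ('i *: y) = rdot x y.
Proof.
by rewrite /rdot -scalerDr !nsqZ /sqmod /= expr0n expr1n add0r !mul1r.
Qed.

Lemma rdotxx x : rdot x x = nsq x.
Proof.
rewrite /rdot -mulr2n -scaler_nat -[2%:R](rmorph_nat (real_complex R)) nsqZ.
by rewrite sqmod_real; lra.
Qed.

Lemma rdot_CauchySchwarz x y : rdot x y ^+ 2 <= nsq x * nsq y.
Proof.
have [x0|x0] := eqVneq (nsq x) 0.
  by rewrite (nsq_eq0 x0) rdot0l nsq0 mul0r expr0n.
have xp : 0 < nsq x by rewrite lt_neqAle eq_sym x0 nsq_ge0.
(* In the notation N, M, b set below, this squared norm expands to N (N M - b^2). *)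
have := nsq_ge0 ((nsq x)%:C *: y - (rdot x y)%:C *: x).
rewrite -rdotxx !(rdotDl, rdotNl, rdotZl) ![rdot _ (_ - _)]rdotC.
rewrite !(rdotDl, rdotNl, rdotZl) !rdotxx (rdotC y x).
set N := nsq x; set M := nsq y; set b := rdot x y => h.
have : 0 <= N * (N * M - b ^+ 2) by apply: le_trans h _; lra.
by rewrite pmulr_rge0// subr_ge0.
Qed.

Definition l2n x : R := Num.sqrt (nsq x).

Lemma l2nD x y : l2n (x + y) <= l2n x + l2n y.
Proof.
rewrite -(@ler_pXn2r _ 2)// ?nnegrE ?addr_ge0 ?sqrtr_ge0//.
rewrite sqrrD !sqr_sqrtr ?nsq_ge0//.
have -> : nsq (x + y) = nsq x + rdot x y *+ 2 + nsq y.
  by rewrite /rdot -mulr_natr; lra.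
rewrite lerD2r lerD2l lerMn2r /=; apply: le_trans (ler_norm _) _.
by rewrite -sqrtr_sqr -sqrtrM ?nsq_ge0// ler_wsqrtr// rdot_CauchySchwarz.
Qed.

Fact l2_ler_normD x y : (l2n (x + y))%:C <= (l2n x)%:C + (l2n y)%:C.
Proof. by rewrite -rmorphD lecR l2nD. Qed.

Fact l2_normrZ (c : R[i]) x : (l2n (c *: x))%:C = `|c| * (l2n x)%:C.
Proof. by rewrite normc_def -rmorphM /l2n nsqZ sqrtrM// sqmod_ge0. Qed.

Fact l2_normr0_eq0 x : (l2n x)%:C = 0 -> x = 0.
Proof.
move=> [] /eqP; rewrite sqrtr_eq0 => x0; apply: nsq_eq0.
by apply/eqP; rewrite eq_le x0 nsq_ge0.
Qed.

HB.instance Definition _ := @Lmodule_isNormed.Build R[i] (l2 R I)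
  _ l2_ler_normD l2_normrZ l2_normr0_eq0.

(** Conjugate-linearity in the second argument forces Re <x, i y> = Im <x, y>, which dictates the
    imaginary part. *)
Definition l2dot x y : R[i] := rdot x y +i* rdot x ('i *: y).

(** Multiplication by i preserves [rdot] and squares to -1, so it is skew-adjoint. *)
Lemma rdot_iC x y : rdot x ('i *: y) = - rdot y ('i *: x).
Proof.
rewrite -(rdot_ii x) scalerA -expr2.
have -> : ('i : R[i]) ^+ 2 = -1 by exact: sqr_i.
by rewrite scaleN1r rdotC rdotNl.
Qed.

Lemma l2dot_linear y : linear_for *%R (l2dot^~ y).
Proof.
move=> [a b] x z; rewrite /l2dot.
have -> : (a +i* b) *: x = a%:C *: x + b%:C *: ('i *: x).
  by rewrite scalerA -scalerDl; congr (_ *: _); simpc.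
rewrite !rdotDl !rdotZl !rdot_ii.
have -> : rdot ('i *: x) y = - rdot x ('i *: y) by rewrite rdotC rdot_iC.
by simpc; congr (_ +i* _); lra.
Qed.

Lemma l2dot_herm x y : l2dot x y = (-1) ^+ false * Num.conj (l2dot y x).
Proof. by rewrite expr0 mul1r /l2dot rdotC rdot_iC. Qed.

Lemma l2dot_linearr x :
  linear_for (Num.conj \; *%R : R[i] -> R[i] -> R[i]) (l2dot x).
Proof.
move=> a y z; rewrite l2dot_herm l2dot_linear expr0 mul1r rmorphD rmorphM.
by rewrite [l2dot x y]l2dot_herm [l2dot x z]l2dot_herm !mul1r.
Qed.

Lemma l2dotxx x : l2dot x x = (nsq x)%:C.
Proof.
rewrite /l2dot rdotxx; congr (_ +i* _).
by have := rdot_iC x x; lra.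
Qed.

Lemma l2dot_pos x : x != 0 -> 0 < l2dot x x.
Proof.
move=> x0; rewrite l2dotxx ltcR lt_neqAle nsq_ge0 andbT.
by apply: contra x0 => /eqP/esym/nsq_eq0 ->.
Qed.

HB.instance Definition _ := @bilinear_isBilinear.Build R[i] (l2 R I) (l2 R I) R[i]
  *%R (Num.conj \; *%R) l2dot (l2dot_linear, l2dot_linearr).
HB.instance Definition _ := @isHermitianSesquilinear.Build R[i] (l2 R I) false
  Num.conj l2dot l2dot_herm.
HB.instance Definition _ := @isDotProduct.Build R[i] (l2 R I) l2dot l2dot_pos.

End L2Norm.

(** * Completeness of the space of square-summable families *)

Section L2Complete.
Variables (R : realType) (I : choiceType).
Implicit Types x y z : l2 R I.

Lemma l2_normE x : `|x| = (l2n x)%:C.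
Proof. by []. Qed.

Lemma sqr_l2n x : l2n x ^+ 2 = nsq x.
Proof. by rewrite sqr_sqrtr ?nsq_ge0. Qed.

Lemma l2nN x : l2n (- x) = l2n x.
Proof.
by rewrite /l2n -scaleN1r nsqZ /sqmod /= oppr0 expr0n sqrrN expr1n addr0 mul1r.
Qed.

Lemma l2_ballE x (e : R) y : ball x e%:C y = (l2n (x - y) < e).
Proof. by rewrite -ball_normE /= l2_normE ltcR. Qed.

Lemma lipschitz_cauchy_cvg (F : set_system (l2 R I)) (g : l2 R I -> R) :
  ProperFilter F -> cauchy F ->
  (forall x y, `|g x - g y| <= l2n (x - y)) -> cvg (g x @[x --> F]).
Proof.
move=> FF /cauchyP Fc glip; apply/cauchy_cvgP/cauchyP => e e0.
have [|x Fx] := Fc e%:C; first by rewrite ltcR.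
exists (g x); suff: F [set y | ball (g x) e (g y)] by [].
apply: filterS Fx => y /=; rewrite l2_ballE => xy.
by rewrite -ball_normE /=; exact: le_lt_trans (glip _ _) xy.
Qed.

Lemma Re_le_l2n x i : `|complex.Re (x i)| <= l2n x.
Proof.
rewrite -sqrtr_sqr ler_wsqrtr//; apply: le_trans (sqmod_le_nsq x i).
by rewrite lerDl sqr_ge0.
Qed.

Lemma Im_le_l2n x i : `|complex.Im (x i)| <= l2n x.
Proof.
rewrite -sqrtr_sqr ler_wsqrtr//; apply: le_trans (sqmod_le_nsq x i).
by rewrite lerDr sqr_ge0.
Qed.

Lemma ReB (a b : R[i]) : complex.Re (a - b) = complex.Re a - complex.Re b.
Proof. by case: a b => ? ? []. Qed.

Lemma ImB (a b : R[i]) : complex.Im (a - b) = complex.Im a - complex.Im b.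
Proof. by case: a b => ? ? []. Qed.

(** The limit z is taken coordinatewise. Each finite partial sum of the |x_i - z_i|^2 is a limit of
    partial sums that are at most e^2 near F, so the whole sum is at most e^2. This gives both the
    square-summability of z and the convergence in norm. *)
Lemma l2_complete (F : set_system (l2 R I)) :
  ProperFilter F -> cauchy F -> cvg F.
Proof.
move=> FF Fc.
have Re_cvg i : cvg (complex.Re ((x : l2 R I) i) @[x --> F]).
  apply: lipschitz_cauchy_cvg => // x y; rewrite -ReB; exact: (Re_le_l2n (x - y)).
have Im_cvg i : cvg (complex.Im ((x : l2 R I) i) @[x --> F]).
  apply: lipschitz_cauchy_cvg => // x y; rewrite -ImB; exact: (Im_le_l2n (x - y)).
pose z i : R[i] := lim (complex.Re ((x : l2 R I) i) @[x --> F])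
  +i* lim (complex.Im ((x : l2 R I) i) @[x --> F]).
have sqr_cvg (f : l2 R I -> R) (b c : R) : f y @[y --> F] --> b ->
    (c - f y) ^+ 2 @[y --> F] --> (c - b) ^+ 2.
  move=> fb; under eq_cvg do rewrite expr2.
  by rewrite expr2; apply: cvgM; apply: cvgB => //; exact: cvg_cst.
have dist_lim (e : R) (x : l2 R I) : F (ball x e%:C) -> 
    (sqsum (l2val x - z)%R <= (e ^+ 2)%:E)%E.
  move=> Fx; apply: ge_ereal_sup => _ /= [X [finX _] <-].
  rewrite fsbig_finite//= sumEFin lee_fin.
  pose S (w : I -> R[i]) := \sum_(i <- fset_set X) sqmod (x i - w i).
  have Scvg : S y @[y --> F] --> S z.
    apply: cvg_big => [|i _]; [exact: add_continuous|]; rewrite /sqmod.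
    under eq_cvg do rewrite ReB ImB.
    rewrite ReB ImB; apply: cvgD; apply: sqr_cvg.
      exact: Re_cvg.
    exact: Im_cvg.
  rewrite -[leLHS]/(S z) -(cvg_lim _ Scvg)//; apply: limr_le.
    by apply/cvg_ex; exists (S z).
  suff: F [set y : l2 R I | S y <= e ^+ 2] by [].
  apply: filterS Fx => y /=; rewrite l2_ballE => xy.
  apply: (@le_trans _ _ (nsq (x - y))); last first.
    by rewrite -sqr_l2n lerXn2r ?nnegrE ?sqrtr_ge0 ?ltW// (le_lt_trans _ xy)// sqrtr_ge0.
  rewrite -lee_fin nsqE -sumEFin -fsbig_finite//.
  by apply: ereal_sup_ubound; exists X.
move: Fc => /cauchyP Fc.
have zP : z \in @square_summable R I.
  have [|x Fx] := Fc 1%:C; first by rewrite ltcR.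
  have xz : l2val x - z \in @square_summable R I.
    apply/square_summableP; apply: le_lt_trans (dist_lim _ _ Fx) _.
    exact: ltry.
  rewrite -[z](subKr (l2val x)); apply: rpredB => //; exact: l2P.
apply/cvg_ex; exists (L2 zP); apply/fcvg_ballP => e e0.
have [|x Fx] := Fc ((complex.Re e / 2)%:C).
  by rewrite ltcR divr_gt0//; move: e0; rewrite ltcE => /andP[].
(* The radius is an element of R[i]; being positive, it is real. *)
move: e0; rewrite ltcE => /andP[/eqP /= ei er].
have eE : e = (complex.Re e)%:C by case: e ei {er Fx} => a b /= ->.
rewrite eE; suff: F [set y | ball (L2 zP) (complex.Re e)%:C y] by [].
apply: filterS (Fx) => y /=; rewrite !l2_ballE => xy.
rewrite -(subrKA x); apply: le_lt_trans (l2nD _ _) _.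
rewrite (splitr (complex.Re e)); apply: (ler_ltD _ xy).
rewrite -opprB l2nN -(@ler_pXn2r _ 2)// ?nnegrE ?sqrtr_ge0 ?divr_ge0 ?(ltW er)//.
by rewrite sqr_l2n -lee_fin nsqE; exact: dist_lim Fx.
Qed.

HB.instance Definition _ := Uniform_isComplete.Build (l2 R I) l2_complete.

Lemma l2_norm_dot x : `|x| ^+ 2 = l2dot x x.
Proof. by rewrite l2_normE -rmorphXn sqr_l2n l2dotxx. Qed.

Definition l2H : hilbertType R := @HilbertType R (l2 R I) (@l2dot R I) l2_norm_dot.

End L2Complete.

(** * Operator and matrix norms *)

Section Operators.
Variables (R : realType) (I : choiceType).
Local Notation H := (l2H R I).

(** [N1] and [N2] stand for squared norms, hence the factor [a ^+ 2]; the bound comes from rescaling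
    x to [N1 x = 1]. *)
Lemma homogeneous_bound (U V : lmodType R[i]) (N1 : U -> R) (N2 : V -> R)
    (A : U -> V) (c : R) :
  (forall x, 0 <= N1 x) ->
  (forall (a : R) x, N1 (a%:C *: x) = a ^+ 2 * N1 x) ->
  (forall (a : R) x, N2 (a%:C *: x) = a ^+ 2 * N2 x) ->
  (forall (a : R) x, A (a%:C *: x) = a%:C *: A x) ->
  (forall x, N1 x <= 1 -> N2 (A x) <= c) ->
  forall x, N2 (A x) <= c * N1 x.
Proof.
move=> N1_ge0 N1Z N2Z AZ Ac x.
have [Nx0|Nx0] := eqVneq (N1 x) 0.
  rewrite Nx0 mulr0 leNgt; apply/negP => Ax0.
  (* This multiple of x still has [N1] equal to 0, while the [N2] of its image would be |c| + 1 >
     c. *)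
  have := Ac ((Num.sqrt ((`|c| + 1) / N2 (A x)))%:C *: x).
  rewrite N1Z Nx0 mulr0 => /(_ ler01).
  rewrite AZ N2Z sqr_sqrtr ?divr_ge0 ?addr_ge0 ?(ltW Ax0)// mulfVK ?gt_eqF//.
  by rewrite leNgt (le_lt_trans (ler_norm c))// ltrDl.
have Nxp : 0 < N1 x by rewrite lt_neqAle eq_sym Nx0 N1_ge0.
have := Ac ((Num.sqrt (N1 x)^-1)%:C *: x).
rewrite N1Z AZ N2Z sqr_sqrtr ?invr_ge0// mulVf// => /(_ (lexx 1)).
by rewrite mulrC ler_pdivrMr.
Qed.

Lemma hnormE (h : H) : hnorm h = l2n h.
Proof. by []. Qed.

Lemma nsqZr (a : R) (x : l2 R I) : nsq (a%:C *: x) = a ^+ 2 * nsq x.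
Proof. by rewrite nsqZ sqmod_real. Qed.

Lemma nsqN (x : l2 R I) : nsq (- x) = nsq x.
Proof. by rewrite -!sqr_l2n l2nN. Qed.

Lemma nsqD_le (x y : l2 R I) : nsq (x + y) <= 2 * nsq x + 2 * nsq y.
Proof.
have := nsq_polar x y (- y); have := nsq_ge0 (x - y).
by rewrite addrK subrr nsq0 nsqN; lra.
Qed.

Lemma opnormP (V W : Type) (nV : V -> R) (nW : W -> R) (D : set V)
    (f : V -> W) (c : R) :
  (opnorm nV nW D f <= c%:E)%E <->
  (forall x, D x -> nV x <= 1 -> nW (f x) <= c).
Proof.
split=> [fc x Dx x1|fc].
  rewrite -lee_fin; apply: le_trans fc; apply: ereal_sup_ubound.
  by exists x.
by apply: ge_ereal_sup => _ /= [x [Dx x1] <-]; rewrite lee_fin; exact: fc.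
Qed.

Lemma linear_fun0 (U V : lmodType R[i]) (A : U -> V) : linear A -> A 0 = 0.
Proof. by move=> linA; have := linA (-1) 0 0; rewrite scaler0 addr0 scaleN1r addNr. Qed.

Lemma linear_funZ (U V : lmodType R[i]) (A : U -> V) (a : R[i]) x :
  linear A -> A (a *: x) = a *: A x.
Proof. by move=> linA; rewrite -[_ *: x]addr0 linA linear_fun0// addr0. Qed.

Lemma linear_le_nsq (A : H -> H) (c : R) : linear A -> 0 <= c ->
  (op_norm A <= c%:E)%E -> forall h, nsq (A h) <= c ^+ 2 * nsq h.
Proof.
move=> linA c0 /opnormP Ac; apply: homogeneous_bound => //.
- exact: nsq_ge0.
- exact: nsqZr.
- exact: nsqZr.
- by move=> a x; rewrite linear_funZ.
- move=> x x1; rewrite -sqr_l2n -hnormE lerXn2r ?nnegrE ?sqrtr_ge0//.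
  apply: Ac => //; rewrite hnormE -(@ler_pXn2r _ 2)// ?nnegrE ?sqrtr_ge0//.
  by rewrite sqr_l2n expr1n.
Qed.

Lemma bounded_operatorsP (A : H -> H) :
  bounded_operators H A <->
  linear A /\ exists2 c : R, 0 <= c & forall h, nsq (A h) <= c ^+ 2 * nsq h.
Proof.
split=> [[linA Aoo]|[linA [c c0 Ac]]]; split=> //.
  have A0 : (0 <= op_norm A)%E.
    apply: le_trans (_ : (hnorm (A 0))%:E <= _)%E; first by rewrite lee_fin sqrtr_ge0.
    apply: ereal_sup_ubound; exists 0 => //; split=> //=.
    by rewrite hnormE /l2n nsq0 sqrtr0.
  exists (fine (op_norm A)); first exact: fine_ge0.
  by apply: linear_le_nsq => //; rewrite ?fine_ge0 ?fineK ?ge0_fin_numE.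
apply: le_lt_trans (ltry c); apply/opnormP => x _.
rewrite !hnormE => x1.
rewrite -(@ler_pXn2r _ 2)// ?nnegrE ?sqrtr_ge0// sqr_l2n.
apply: le_trans (Ac x) _; rewrite ler_piMr ?sqr_ge0// -sqr_l2n.
by rewrite expr_le1// sqrtr_ge0.
Qed.

Definition sumnsq (n : nat) (h : 'I_n -> l2 R I) : R := \sum_i nsq (h i).

Lemma sumnsq_ge0 n (h : 'I_n -> l2 R I) : 0 <= sumnsq h.
Proof. by apply: sumr_ge0 => i _; exact: nsq_ge0. Qed.

Lemma sqr_l2norm n (h : 'I_n -> H) : l2norm h ^+ 2 = sumnsq h.
Proof.
rewrite /l2norm; under eq_bigr do rewrite hnormE sqr_l2n.
by rewrite sqr_sqrtr// sumnsq_ge0.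
Qed.

Lemma l2norm_le n (h : 'I_n -> H) (c : R) : 0 <= c ->
  (l2norm h <= c) = (sumnsq h <= c ^+ 2).
Proof.
by move=> c0; rewrite -(@ler_pXn2r _ 2)// ?nnegrE ?sqrtr_ge0// sqr_l2norm.
Qed.

Lemma opnorm_mx_ge0 n (T : 'M[H -> H]_n) :
  (0 <= opnorm (@l2norm R H n) (@l2norm R H n) setT (mx_action T))%E.
Proof.
apply: le_trans (_ : (l2norm (mx_action T 0))%:E <= _)%E.
  by rewrite lee_fin sqrtr_ge0.
apply: ereal_sup_ubound; exists 0 => //; split=> //=.
by rewrite l2norm_le// /sumnsq big1 ?expr1n// => i _; rewrite nsq0.
Qed.

Lemma mxnorm_le n (T : 'M[H -> H]_n) (c : R) : 0 <= c ->
  (forall h, sumnsq h <= 1 -> sumnsq (mx_action T h) <= c ^+ 2) ->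
  mxnorm T <= c.
Proof.
move=> c0 Tc; rewrite /mxnorm.
set N := opnorm _ _ _ _.
have : (N <= c%:E)%E.
  apply/opnormP => h _ h1; rewrite l2norm_le//; apply: Tc.
  by rewrite l2norm_le// expr1n in h1.
by case: N => [r||]//=; rewrite lee_fin.
Qed.

Lemma mxnorm_ge n (T : 'M[H -> H]_n) :
  (forall i j, bounded_operators H (T i j)) ->
  0 <= mxnorm T /\
  forall h, sumnsq (mx_action T h) <= mxnorm T ^+ 2 * sumnsq h.
Proof.
move=> Tb.
have N0 := opnorm_mx_ge0 T.
have Tlin i j : linear (T i j) by case: (Tb i j).
(* [mxnorm] applies [fine], which sends +oo to 0, so finiteness comes first. By the triangle
   inequality, component i of the image of the unit ball is bounded by the sum over j of the bounds
   of the entries (i, j). *)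
have Noo : (opnorm (@l2norm R H n) (@l2norm R H n) setT (mx_action T) < +oo)%E.
  have /choice [c cP] : forall ij : 'I_n * 'I_n, exists c : R,
      0 <= c /\ forall h, nsq (T ij.1 ij.2 h) <= c ^+ 2 * nsq h.
    by move=> [i j]; have /bounded_operatorsP [_ [c c0 cT]] := Tb i j; exists c.
  apply: le_lt_trans (ltry (Num.sqrt (\sum_i (\sum_j c (i, j)) ^+ 2))).
  apply/opnormP => h _; rewrite l2norm_le// expr1n => h1.
  rewrite ler_wsqrtr// ler_sum// => i _; rewrite hnormE.
  rewrite lerXn2r ?nnegrE ?sqrtr_ge0 ?sumr_ge0//; first by move=> j _; case: (cP (i, j)).
  apply: (@le_trans _ _ (\sum_j l2n (T i j (h j)))).
    rewrite /mx_action; elim/big_ind2 : _ => //.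
      by rewrite /l2n nsq0 sqrtr0.
    by move=> x1 x2 y1 y2 h1' h2'; apply: le_trans (l2nD _ _) _; exact: lerD.
  apply: ler_sum => j _; have [c0 cT] := cP (i, j).
  rewrite -(@ler_pXn2r _ 2)// ?nnegrE ?sqrtr_ge0// sqr_l2n.
  apply: le_trans (cT (h j)) _; rewrite ler_piMr ?sqr_ge0//.
  apply: le_trans h1; rewrite /sumnsq (bigD1 j)//= lerDl.
  by apply: sumr_ge0 => k _; exact: nsq_ge0.
split; first exact: fine_ge0.
apply: homogeneous_bound.
- exact: sumnsq_ge0.
- by move=> a x; rewrite /sumnsq mulr_sumr; apply: eq_bigr => i _; rewrite nsqZr.
- by move=> a x; rewrite /sumnsq mulr_sumr; apply: eq_bigr => i _; rewrite nsqZr.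
- move=> a x; apply/funext => i; rewrite /mx_action.
  rewrite [RHS]scaler_sumr; by apply: eq_bigr => j _; rewrite linear_funZ.
- move=> h h1; rewrite -l2norm_le; last exact: fine_ge0.
  rewrite -lee_fin fineK ?ge0_fin_numE//; apply: ereal_sup_ubound.
  by exists h => //; split=> //=; rewrite l2norm_le// expr1n.
Qed.

End Operators.

(** * Block-column operators *)

Section BasisVectors.
Variables (R : realType) (I : choiceType).

(* mkl2 x is 0 when x is not square-summable. *)
Definition mkl2 (x : I -> R[i]) : l2 R I := insubd 0 x.

Lemma mkl2E (x : I -> R[i]) p : (sqsum x < +oo)%E -> mkl2 x p = x p.
Proof.
by move=> /square_summableP xP; rewrite /mkl2 /insubd insubT.
Qed.

Lemma sqsum_mkl2 (x : I -> R[i]) : (sqsum x < +oo)%E ->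
  (nsq (mkl2 x))%:E = sqsum x.
Proof. by move=> xoo; rewrite nsqE; apply: eq_esum => i _; rewrite mkl2E. Qed.

Definition delta (p : I) : l2 R I := mkl2 (fun q => (q == p)%:R).

Lemma sqsum_delta p : sqsum (fun q : I => (q == p)%:R : R[i]) = 1%:E.
Proof.
have <- := @esum_set1 R I p (fun _ : I => 1%:E) lee01.
rewrite [RHS]esum_mkcond.
apply: eq_esum => q _; have -> : (q \in [set p]) = (q == p) by apply/idP/eqP; rewrite inE.
case: (q == p).
  by rewrite -[1%:R]/(1%:C) sqmod_real expr1n.
by rewrite sqmod0.
Qed.

Lemma deltaE p q : delta p q = (q == p)%:R.
Proof. by rewrite mkl2E// sqsum_delta ltry. Qed.

Lemma nsq_delta p : nsq (delta p) = 1.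
Proof. by apply: EFin_inj; rewrite sqsum_mkl2 sqsum_delta ?ltry. Qed.

Lemma l2D (x y : l2 R I) p : (x + y) p = x p + y p. Proof. by []. Qed.
Lemma l2Z (a : R[i]) (x : l2 R I) p : (a *: x) p = a * x p. Proof. by []. Qed.
Lemma l2B (x y : l2 R I) p : (x - y) p = x p - y p. Proof. by []. Qed.
Lemma l2_sum (J : Type) (r : seq J) (P : pred J) (F : J -> l2 R I) p :
  (\sum_(j <- r | P j) F j) p = \sum_(j <- r | P j) F j p.
Proof. by elim/big_rec2: _ => // j x y _ <-. Qed.

Lemma l2_ext (x y : l2 R I) : (forall p, x p = y p) -> x = y.
Proof. by move=> xy; apply/val_inj/funext. Qed.

End BasisVectors.

Section BlockColumns.
Variables (R : realType) (T : choiceType).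
Let I : choiceType := (T * nat)%type.
Local Notation H := (l2H R I).

Lemma sqsum_blocks (x : I -> R[i]) : sqsum x =
  (\esum_(t in [set: T]) \esum_(m in [set: nat]) (sqmod (x (t, m)))%:E)%E.
Proof.
rewrite (@esum_esum R T nat setT (fun=> setT) (fun t m => (sqmod (x (t, m)))%:E)).
  rewrite /sqsum; have -> : [set: I] = [set: T] `*`` (fun=> [set: nat]).
    by apply/seteqP; split.
  by apply: eq_esum => -[].
by move=> t m _ _; rewrite lee_fin sqmod_ge0.
Qed.

Lemma esum_row_ge0 (x : I -> R[i]) t :
  (0 <= \esum_(m in [set: nat]) (sqmod (x (t, m)))%:E)%E.
Proof. by apply: esum_ge0 => m _; rewrite lee_fin sqmod_ge0. Qed.

Lemma esum_single_le (J : choiceType) (a : J -> \bar R) j :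
  (forall j, 0 <= a j)%E -> (a j <= \esum_(k in [set: J]) a k)%E.
Proof.
move=> a0; rewrite -(@esum_set1 R J j a)//.
by apply: ereal_sup_le; apply: image_subset => A [? ?]; split.
Qed.

Lemma esum_row_le (x : I -> R[i]) t :
  (\esum_(m in [set: nat]) (sqmod (x (t, m)))%:E <= sqsum x)%E.
Proof.
rewrite sqsum_blocks.
exact: (@esum_single_le T (fun t => \esum_(m in [set: nat]) (sqmod (x (t, m)))%:E)%E
   t (esum_row_ge0 x)).
Qed.

Lemma esum_head_le (x : I -> R[i]) :
  (\esum_(t in [set: T]) (sqmod (x (t, 0%N)))%:E <= sqsum x)%E.
Proof.
rewrite sqsum_blocks; apply: le_esum => t _.
apply: (@esum_single_le nat (fun m => (sqmod (x (t, m)))%:E)) => m.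
by rewrite lee_fin sqmod_ge0.
Qed.

(* In an index (t, m), t is a block and m a coordinate in this block: A maps the
   coordinate (t, 0) of a vector to a fixed column of the block t, and ignores
   the coordinates (t, m) with 0 < m. *)
Definition block_column (A : H -> H) : Prop := forall (h : H) t m,
  A h (t, m) = h (t, 0%N) * A (delta R (t, 0%N)) (t, m).

Definition bcol : set (H -> H) :=
  [set A | bounded_operators H A /\ block_column A].

Definition colop (y : I -> R[i]) (h : H) : H :=
  mkl2 (fun p => h (p.1, 0%N) * y p).

Section Colop.
Variables (y : I -> R[i]) (M : R).
Hypothesis M0 : 0 <= M.
Hypothesis yM : forall t, (\esum_(m in [set: nat]) (sqmod (y (t, m)))%:E <= M%:E)%E.

(** Distinct blocks read distinct coordinates and write into orthogonal subspaces, so a bound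
    uniform in t on the columns bounds the whole operator. *)
Lemma sqsum_colop (h : H) :
  (sqsum (fun p : I => (h (p.1, 0%N) * y p)%R) <= M%:E * sqsum h)%E.
Proof.
rewrite sqsum_blocks.
apply: (@le_trans _ _ (\esum_(t in [set: T]) (M%:E * (sqmod (h (t, 0%N)))%:E))%E).
  apply: le_esum => t _; under eq_esum do rewrite /= sqmodM EFinM.
  rewrite esumZl ?sqmod_ge0//; last by move=> m; rewrite lee_fin sqmod_ge0.
  by rewrite muleC lee_wpmul2r// lee_fin sqmod_ge0.
rewrite esumZl//; last by move=> t; rewrite lee_fin sqmod_ge0.
by rewrite lee_wpmul2l//; exact: esum_head_le.
Qed.

Lemma colopE (h : H) p : colop y h p = h (p.1, 0%N) * y p.
Proof.
rewrite mkl2E//; apply: le_lt_trans (sqsum_colop h) _.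
by rewrite -nsqE -EFinM ltry.
Qed.

Lemma colop_delta t p : colop y (delta R (t, 0%N)) p = (p.1 == t)%:R * y p.
Proof. by rewrite colopE deltaE xpair_eqE eqxx andbT. Qed.

Lemma colop_bcol : bcol (colop y).
Proof.
split; last by move=> h t m; rewrite colopE colop_delta eqxx mul1r.
apply/bounded_operatorsP; split.
  by move=> a h k; apply: l2_ext => p; rewrite l2D l2Z !colopE l2D l2Z mulrDl mulrA.
exists (Num.sqrt M); first exact: sqrtr_ge0.
move=> h; rewrite sqr_sqrtr// -lee_fin sqsum_mkl2 ?EFinM ?nsqE; last first.
  by apply: le_lt_trans (sqsum_colop h) _; rewrite -nsqE -EFinM ltry.
exact: sqsum_colop.
Qed.

End Colop.

(** The block t of the output depends only on the scalars [h j (t, 0)]. Hence the estimate can be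
    checked block by block on C^n and summed over t. *)
Lemma bcol_mx_le n (A : 'M[H -> H]_n) (M : R) :
  (forall i j, bcol (A i j)) -> 0 <= M ->
  (forall t (c : 'I_n -> R[i]),
     sumnsq (fun i => \sum_j c j *: A i j (delta R (t, 0%N)))
       <= M * \sum_j sqmod (c j)) ->
  forall h : 'I_n -> H, sumnsq (mx_action A h) <= M * sumnsq h.
Proof.
move=> Ab M0 AM h.
pose w i t := \sum_j h j (t, 0%N) *: A i j (delta R (t, 0%N)).
have AE i t m : mx_action A h i (t, m) = w i t (t, m).
  rewrite /mx_action !l2_sum; apply: eq_bigr => j _.
  by rewrite l2Z; have [_ ->] := Ab i j.
rewrite -lee_fin EFinM /sumnsq -!sumEFin.
under eq_bigr do rewrite nsqE sqsum_blocks.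
rewrite -esum_sum; last by move=> t i _ _; exact: esum_row_ge0.
apply: (@le_trans _ _ (\esum_(t in [set: T])
    (M%:E * \sum_j (sqmod (h j (t, 0%N)))%:E))%E).
  apply: le_esum => t _; rewrite [X in (_ <= _ * X)%E]sumEFin -EFinM.
  apply: le_trans (_ : (sumnsq (w^~ t))%:E <= _)%E; last by rewrite lee_fin; exact: AM.
  rewrite /sumnsq -sumEFin; apply: lee_sum => i _.
  rewrite nsqE; apply: le_trans (esum_row_le _ t).
  by apply: le_esum => m _; rewrite AE.
rewrite esumZl//; last by move=> t; apply: sume_ge0 => j _; rewrite lee_fin sqmod_ge0.
rewrite lee_wpmul2l ?lee_fin// esum_sum; last by move=> t j _ _; rewrite lee_fin sqmod_ge0.
by apply: lee_sum => j _; rewrite nsqE; exact: esum_head_le.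
Qed.

End BlockColumns.

(** * The two operator spaces and their closedness *)

Section OperatorSpaces.
Variables (R : realType) (T : choiceType).
Let I : choiceType := (T * nat)%type.
Local Notation H := (l2H R I).
Local Notation delta0 t := (delta R (t, 0%N) : H).

Lemma bounded_operators_lin (a : R[i]) (A B : H -> H) :
  bounded_operators H A -> bounded_operators H B ->
  bounded_operators H (a *: A + B).
Proof.
move=> /bounded_operatorsP[linA [c c0 Ac]] /bounded_operatorsP[linB [d d0 Bd]].
apply/bounded_operatorsP; split.
  move=> b h k; rewrite /= -!/(_ + _).
  rewrite ![(a *: A + B) _]/(a *: A _ + B _) linA linB !scalerDr !scalerA.
  by rewrite addrACA [a * b]mulrC.
exists (Num.sqrt (2 * (sqmod a * c ^+ 2) + 2 * d ^+ 2)); first exact: sqrtr_ge0.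
move=> h; rewrite sqr_sqrtr ?addr_ge0 ?mulr_ge0 ?sqmod_ge0 ?sqr_ge0//.
rewrite [(a *: A + B) _]/(a *: A _ + B _); apply: le_trans (nsqD_le _ _) _.
rewrite nsqZ [leRHS]mulrDl -!(mulrA 2) -(mulrA (sqmod a)).
by rewrite lerD// ler_wpM2l// ler_wpM2l ?sqmod_ge0.
Qed.

Lemma bounded_operators0 : bounded_operators H (0 : H -> H).
Proof.
apply/bounded_operatorsP; split; first by move=> a h k; rewrite scaler0 addr0.
by exists 0 => // h; rewrite nsq0 mulr_ge0 ?sqr_ge0 ?nsq_ge0.
Qed.

Lemma op_norm_approx (X : set (H -> H)) (A : H -> H) :
  X `<=` bounded_operators H -> bounded_operators H A ->
  (forall e : R, 0 < e ->
     exists2 S : H -> H, X S & (op_norm (S - A)%R < e%:E)%E) ->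
  forall e : R, 0 < e ->
    exists2 S : H -> H, X S & forall h, nsq (A h - S h) <= e * nsq h.
Proof.
move=> Xb Ab XA e e0; have [|S XS SA] := XA (Num.sqrt e).
  by rewrite sqrtr_gt0.
exists S => // h; rewrite -nsqN opprB.
have /bounded_operators_lin/(_ (Xb _ XS)) SAb : bounded_operators H A by [].
have opSA : (op_norm (-1 *: A + S)%R <= (Num.sqrt e)%:E)%E.
  by rewrite scaleN1r addrC ltW.
have := linear_le_nsq (SAb (-1)).1 (sqrtr_ge0 e) opSA h.
rewrite sqr_sqrtr ?(ltW e0)//.
by rewrite [(-1 *: A + S) _]/(-1 *: A h + S h) scaleN1r addrC.
Qed.

Lemma sqmod_arb_small (z : R[i]) (K : R) : 0 <= K ->
  (forall e : R, 0 < e -> sqmod z <= e * K) -> z = 0.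
Proof.
move=> K0 zK; apply: sqmod_eq0; apply/eqP; rewrite eq_le sqmod_ge0 andbT.
rewrite leNgt; apply/negP => z0.
have K1 : 0 < K + 1 by rewrite ltr_wpDl.
have := zK (sqmod z / (K + 1)); rewrite divr_gt0// => /(_ isT).
rewrite -mulrA ler_pMr// mulrC ler_pdivlMr// mul1r; lra.
Qed.

Lemma bcol_ospace : operator_space (@bcol R T).
Proof.
split.
- by move=> A [].
- split; first exact: bounded_operators0.
  by move=> h t m; rewrite [LHS]/(0 : R[i]) [X in _ = _ * X]/(0 : R[i]) mulr0.
- move=> a A B [Ab Ac] [Bb Bc]; split; first exact: bounded_operators_lin.
  move=> h t m; rewrite ![(a *: A + B) _]/(a *: A _ + B _) !l2D !l2Z Ac Bc.
  by rewrite mulrDr mulrCA.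
- move=> A Ab /(@op_norm_approx _ _ _ Ab) XA; split=> // h t m.
  apply/eqP; rewrite -subr_eq0; apply/eqP.
  apply: (@sqmod_arb_small _ (4 * nsq h)); first by rewrite mulr_ge0// nsq_ge0.
  move=> e e0; have [|S [_ Sc] AS] := XA _ e e0; first by move=> ? [].
  (* The defect of A in the block-column law is rewritten in terms of A - S, the defect of S being
     0. Each of the two terms then contributes at most 2 e [nsq h], whence the constant 4. *)
  have -> : A h (t, m) - h (t, 0%N) * A (delta0 t) (t, m) =
    (A h - S h) (t, m) + (- h (t, 0%N)) * (A (delta0 t) - S (delta0 t)) (t, m).
    rewrite !l2B Sc; ring.
  apply: le_trans (sqmodD_le _ _) _.
  rewrite sqmodM.
  have h1 := le_trans (sqmod_le_nsq (A h - S h) (t, m)) (AS h).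
  have := le_trans (sqmod_le_nsq (A (delta0 t) - S (delta0 t)) (t, m)) (AS _).
  rewrite nsq_delta mulr1 => h2.
  have h3 : sqmod (- h (t, 0%N)) <= nsq h.
    rewrite -mulN1r sqmodM {1}/sqmod /= oppr0 sqrrN expr1n expr0n addr0 mul1r.
    exact: sqmod_le_nsq.
  have := ler_pM (sqmod_ge0 _) (sqmod_ge0 _) h3 h2; nra.
Qed.

(* The c0-sum of finite-dimensional column spaces. *)
Definition fcol (lev : T -> nat) : set (H -> H) :=
  [set A | [/\ bcol A,
     forall t m, (lev t <= m)%N -> A (delta0 t) (t, m) = 0 &
     forall e : R, 0 < e ->
       exists N, forall t, (N <= lev t)%N -> nsq (A (delta0 t)) <= e]].

Lemma fcol_ospace lev : operator_space (fcol lev).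
Proof.
have [bb b0 bl bc] := bcol_ospace.
have fb : fcol lev `<=` bounded_operators H by move=> A [/bb].
split=> //.
- split=> // e e0; exists 0%N => t _.
  by rewrite [X in nsq X]/(0 : l2 R I) nsq0 ltW.
- move=> a A B [Ab Av Ac] [Bb Bv Bc]; split; first exact: bl.
    move=> t m tm; rewrite ![(a *: A + B) _]/(a *: A _ + B _) l2D l2Z Av// Bv//.
    by rewrite mulr0 addr0.
  move=> e e0.
  (* [nsqD_le] costs a factor 2, so each summand is made to contribute at most e / 2; the + 1 avoids
     a division by 0. *)
  have [|N NA] := Ac (e / (4 * (sqmod a + 1))).
    by rewrite divr_gt0// mulr_gt0// ltr_wpDl// sqmod_ge0.
  have [|M MB] := Bc (e / 4); first by rewrite divr_gt0.
  exists (maxn N M) => t; rewrite geq_max => /andP[Nt Mt].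
  rewrite ![(a *: A + B) _]/(a *: A _ + B _); apply: le_trans (nsqD_le _ _) _.
  have := MB t Mt; have := NA t Nt; rewrite nsqZ.
  have a0 := sqmod_ge0 a; have a1 : 0 < 4 * (sqmod a + 1) by lra.
  rewrite ler_pdivlMr//; have := nsq_ge0 (A (delta0 t)); nra.
- move=> A Ab XA; have XA' := @op_norm_approx _ _ fb Ab XA.
  split.
  + apply: bc => // e /XA[S [Sb _ _] SA]; by exists S.
  + move=> t m tm; apply: (@sqmod_arb_small _ 1) => // e e0.
    have [S [_ Sv _] AS] := XA' e e0; rewrite -(nsq_delta R (t, 0%N)).
    apply: le_trans (AS _); apply: le_trans (sqmod_le_nsq _ (t, m)).
    by rewrite l2B Sv// subr0.
  + move=> e e0; have [|S [_ _ Sc] AS] := XA' (e / 4); first by rewrite divr_gt0.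
    have [|N NS] := Sc (e / 4); first by rewrite divr_gt0.
    exists N => t Nt; have := NS t Nt; have := AS (delta0 t); rewrite nsq_delta.
    have := nsqD_le (A (delta0 t) - S (delta0 t)) (S (delta0 t)).
    rewrite subrK; lra.
Qed.

End OperatorSpaces.

(** * The level-wise isometric embeddings *)

Section DotProduct.
Variables (R : realType) (I : choiceType).
Implicit Types x y z : l2 R I.

Lemma dotDl x y z : l2dot (x + y) z = l2dot x z + l2dot y z.
Proof. by rewrite -[x]scale1r l2dot_linear mul1r scale1r. Qed.

Lemma dot0l z : l2dot 0 z = 0.
Proof. by have := l2dot_linear z (-1) 0 0; rewrite scaler0 addr0 mulN1r addNr. Qed.

Lemma dotZl a x z : l2dot (a *: x) z = a * l2dot x z.
Proof. by rewrite -[a *: x]addr0 l2dot_linear dot0l addr0. Qed.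

Lemma dotC x y : l2dot x y = Num.conj (l2dot y x).
Proof. by rewrite l2dot_herm expr0 mul1r. Qed.

Lemma conj_realC (a : R) : Num.conj (a%:C : R[i]) = a%:C.
Proof. exact: conjc_real. Qed.

Lemma dot_suml (J : Type) (r : seq J) (P : pred J) (F : J -> l2 R I) z :
  l2dot (\sum_(j <- r | P j) F j) z = \sum_(j <- r | P j) l2dot (F j) z.
Proof. by elim/big_rec2: _ => [|j x y _ <-]; rewrite ?dot0l ?dotDl. Qed.

Lemma dotBl x y z : l2dot (x - y) z = l2dot x z - l2dot y z.
Proof. by rewrite dotDl -scaleN1r dotZl mulN1r. Qed.

Lemma dotBr x y z : l2dot x (y - z) = l2dot x y - l2dot x z.
Proof. by rewrite dotC dotBl rmorphB [l2dot x y]dotC [l2dot x z]dotC. Qed.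

Lemma mul_conj_sqmod (a : R[i]) : a * Num.conj a = (sqmod a)%:C.
Proof. by rewrite sqmodE normCK. Qed.

(* This is the orthogonal projection onto the span of v 0, ..., v (n - 1) only
   when these vectors are pairwise orthogonal, of norm 0 or 1. *)
Definition dot_proj n (v : nat -> l2 R I) x : l2 R I :=
  \sum_(m < n) l2dot x (v m) *: v m.

Lemma dot_proj_dot n v x : l2dot (dot_proj n v x) x =
  (\sum_(m < n) sqmod (l2dot x (v m)))%:C.
Proof.
rewrite dot_suml rmorph_sum; apply: eq_bigr => m _.
by rewrite dotZl [l2dot (v m) x]dotC mul_conj_sqmod.
Qed.

(** Normalization with v = 0 for x = 0, so that Gram-Schmidt runs on dependent families as well. The
    second property covers the norms 0 and 1 of v at once. *)
Lemma normalize x : exists v, [/\ exists a, v = a *: x,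
  forall y, l2dot y v * l2dot v v = l2dot y v & l2dot x v *: v = x].
Proof.
have [->|x0] := eqVneq x 0.
  exists 0; split; first by exists 0; rewrite scaler0.
    by move=> y; rewrite dot0l mulr0 dotC dot0l rmorph0.
  by rewrite scaler0.
have n0 : nsq x != 0 by apply: contra x0 => /eqP/nsq_eq0 ->.
have s0 : l2n x != 0 by rewrite -sqrf_eq0 sqr_l2n.
have xv : l2dot x ((l2n x)^-1%:C *: x) = (l2n x)%:C.
  by rewrite dotC dotZl l2dotxx -sqr_l2n -rmorphM expr2 mulKf// conj_realC.
exists ((l2n x)^-1%:C *: x); split.
- by exists ((l2n x)^-1%:C).
- by move=> y; rewrite dotZl xv -rmorphM mulVf// mulr1.
- by rewrite xv scalerA -rmorphM divff// scale1r.
Qed.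

(** The induction normalizes the part of [z n] orthogonal to the previous vectors. The first
    property says that x minus its projection is orthogonal to every [v j], the second that the
    [z k] lie in the span. *)
Lemma gram_schmidt n (z : nat -> l2 R I) : exists v : nat -> l2 R I,
  (forall x j, (j < n)%N -> l2dot (dot_proj n v x) (v j) = l2dot x (v j)) /\
  (forall k, (k < n)%N -> dot_proj n v (z k) = z k).
Proof.
elim: n => [|n [v [vP zP]]]; first by exists (fun=> 0).
pose w := z n - dot_proj n v (z n).
have wv j : (j < n)%N -> l2dot w (v j) = 0.
  by move=> jn; rewrite dotBl vP// subrr.
have [u [[a ua] uu wu]] := normalize w.
have uv j : (j < n)%N -> l2dot u (v j) = 0.
  by move=> jn; rewrite ua dotZl wv// mulr0.
have Pu x : l2dot (dot_proj n v x) u = 0.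
  rewrite dot_suml big1// => m _; rewrite dotZl [l2dot (v m) u]dotC uv//.
  by rewrite rmorph0 mulr0.
pose v' m := if m == n then u else v m.
have v'n : v' n = u by rewrite /v' eqxx.
have PE x : dot_proj n.+1 v' x = dot_proj n v x + l2dot x u *: u.
  rewrite /dot_proj big_ord_recr /= /v' eqxx; congr (_ + _).
  by apply: eq_bigr => m _; rewrite ltn_eqF.
exists v'; split => [x j|k]; rewrite ltnS leq_eqVlt => /predU1P[->|jn].
- by rewrite PE v'n dotDl Pu add0r dotZl uu.
- by rewrite PE /v' ltn_eqF// dotDl vP// dotZl uv// mulr0 addr0.
(* The range of the old projection is orthogonal to u, so [z n] and w have the same coefficient
   along u. *)
- rewrite PE; have -> : l2dot (z n) u = l2dot w u by rewrite dotBl Pu subr0.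
  by rewrite wu addrC subrK.
- by rewrite PE zP// -(zP k)// Pu scale0r addr0.
Qed.

Definition bessel n (v : nat -> l2 R I) :=
  forall x, \sum_(m < n) sqmod (l2dot x (v m)) <= nsq x.

(** Pythagoras: the sum is the squared norm of the projection of x, hence at most [nsq x], with
    equality for the [z k], which are their own projections. *)
Lemma gram_schmidt_bessel n (z : nat -> l2 R I) : exists2 v, bessel n v &
  forall k, (k < n)%N -> \sum_(m < n) sqmod (l2dot (z k) (v m)) = nsq (z k).
Proof.
have [v [vP zP]] := gram_schmidt n z; exists v => [x|k kn].
  set s := \sum_(m < n) _.
  have Px : l2dot (dot_proj n v x) x = s%:C := dot_proj_dot n v x.
  have PP : l2dot (dot_proj n v x) (dot_proj n v x) = s%:C.
    rewrite {1}/dot_proj dot_suml rmorph_sum; apply: eq_bigr => m _.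
    by rewrite dotZl [l2dot (v m) _]dotC vP// mul_conj_sqmod.
  suff -> : nsq x = nsq (x - dot_proj n v x) + s by rewrite lerDr nsq_ge0.
  apply: complexI; rewrite rmorphD -[X in _ = X + _]l2dotxx dotBl !dotBr PP Px.
  by rewrite [l2dot x (dot_proj _ _ _)]dotC Px conj_realC subrr subr0 l2dotxx subrK.
by apply: complexI; rewrite -dot_proj_dot zP// l2dotxx.
Qed.

End DotProduct.

Lemma esum_nat_fin (R : realType) n (a : nat -> \bar R) :
  (forall m, 0 <= a m)%E -> (forall m, (n <= m)%N -> a m = 0%E) ->
  (\esum_(m in [set: nat]) a m = \sum_(m < n) a m)%E.
Proof.
move=> a0 an; rewrite -(nneseries_esumT a0).
rewrite (nneseries_split 0 n)// [X in (_ + X)%E]eseries0 ?adde0 ?add0n ?big_mkord//.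
by move=> m nm _; exact: an.
Qed.

Section BlockColumnMatrices.
Variables (R : realType) (T : choiceType).
Let I : choiceType := (T * nat)%type.
Local Notation H := (l2H R I).
Local Notation delta0 t := (delta R (t, 0%N) : H).

Lemma nsq_one_block (z : l2 R I) t : (forall p, p.1 != t -> z p = 0) ->
  (nsq z)%:E = (\esum_(m in [set: nat]) (sqmod (z (t, m)))%:E)%E.
Proof.
move=> zt; rewrite nsqE sqsum_blocks.
have <- := @esum_set1 R T t
  (fun s => \esum_(m in [set: nat]) (sqmod (z (s, m)))%:E)%E (esum_row_ge0 z t).
rewrite [RHS]esum_mkcond; apply: eq_esum => s _.
have -> : (s \in [set t]) = (s == t) by apply/idP/eqP; rewrite inE.
have [//|st] := eqVneq s t.
by rewrite esum1// => m _; rewrite zt ?sqmod0.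
Qed.

(** With [mxnorm_bcol_ge], this computes the norm of a matrix of block columns as the supremum over
    the blocks t of its norm as a map on C^n. *)
Lemma mxnorm_bcol_le n (A : 'M[H -> H]_n) (M : R) :
  (forall i j, bcol (A i j)) -> 0 <= M ->
  (forall t (c : 'I_n -> R[i]),
     sumnsq (fun i => \sum_j c j *: A i j (delta0 t))
       <= M ^+ 2 * \sum_j sqmod (c j)) ->
  mxnorm A <= M.
Proof.
move=> Ab M0 AM; apply: mxnorm_le => // h h1.
apply: le_trans (bcol_mx_le Ab (sqr_ge0 M) AM h) _.
by rewrite ler_piMr ?sqr_ge0.
Qed.

(** The matrix is tested on the vectors [c j *: delta0 t]. *)
Lemma mxnorm_bcol_ge n (A : 'M[H -> H]_n) t (c : 'I_n -> R[i]) :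
  (forall i j, bcol (A i j)) ->
  sumnsq (fun i => \sum_j c j *: A i j (delta0 t))
    <= mxnorm A ^+ 2 * \sum_j sqmod (c j).
Proof.
move=> Ab; have Abd i j : bounded_operators H (A i j) by case: (Ab i j).
have [_ /(_ (fun j => c j *: delta0 t))] := mxnorm_ge Abd.
rewrite /sumnsq /mx_action.
under [X in _ <= _ * X]eq_bigr do rewrite nsqZ nsq_delta mulr1.
apply: le_trans; rewrite le_eqVlt; apply/orP; left; apply/eqP.
apply: eq_bigr => i _; congr nsq; apply: eq_bigr => j _.
by rewrite linear_funZ//; case: (Abd i j).
Qed.

Lemma mxnorm_bcol_ge0 n (A : 'M[H -> H]_n) :
  (forall i j, bcol (A i j)) -> 0 <= mxnorm A.
Proof. by move=> Ab; apply: (mxnorm_ge _).1 => i j; case: (Ab i j). Qed.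

End BlockColumnMatrices.

(** * Compressions of the column space to finite columns *)

Section Compressions.
Variable R : realType.
Let I : choiceType := (unit * nat)%type.
Local Notation H := (l2H R I).
Let T : choiceType := (nat * (nat -> l2 R I))%type.
Local Notation K := (l2H R (T * nat)%type).
Local Notation e0 := (delta R (tt, 0%N) : H).
Local Notation delta0 t := (delta R ((t, 0%N) : T * nat) : K).

(* A block t is a pair (n, v); only the blocks for which the first n vectors of
   v form a Bessel family are used. *)
Definition level (t : T) : nat := t.1.

(** Only the blocks of size exactly n are filled: they suffice for the isometry on M_n, and leaving
    the larger ones at 0 keeps the image in the c0-sum. *)
Definition coef n (x : l2 R I) (p : T * nat) : R[i] :=
  if [&& p.1.1 == n, (p.2 < n)%N & `[< bessel n p.1.2 >]]
  then l2dot x (p.1.2 p.2) else 0.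

Lemma coef_linear n a x y p : coef n (a *: x + y) p = a * coef n x p + coef n y p.
Proof. by rewrite /coef; case: ifP => _; rewrite ?l2dot_linear// mulr0 addr0. Qed.

Lemma coef0 n p : coef n 0 p = 0.
Proof. by rewrite /coef dot0l if_same. Qed.

Lemma coef_sum n k (c : 'I_k -> R[i]) (x : 'I_k -> l2 R I) p :
  coef n (\sum_j c j *: x j) p = \sum_j c j * coef n (x j) p.
Proof.
by elim/big_rec2: _ => [|j y z _ <-]; rewrite ?coef0 ?coef_linear.
Qed.

Lemma esum_coef n x (t : T) :
  (\esum_(m in [set: nat]) (sqmod (coef n x (t, m)))%:E)%E =
  (if (t.1 == n) && `[< bessel n t.2 >]
   then \sum_(m < n) sqmod (l2dot x (t.2 m)) else 0)%:E.
Proof.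
rewrite (@esum_nat_fin _ n); last 2 first.
- by move=> m; rewrite lee_fin sqmod_ge0.
- by move=> m nm; rewrite /coef /= [(m < n)%N]ltnNge nm andbF sqmod0.
rewrite sumEFin; congr (_%:E); rewrite /coef /=; case: ifP => [/andP[-> ->]|tn].
  by apply: eq_bigr => m _; rewrite ltn_ord.
by rewrite big1// => m _; rewrite ltn_ord /= tn sqmod0.
Qed.

Lemma esum_coef_le n x (t : T) :
  (\esum_(m in [set: nat]) (sqmod (coef n x (t, m)))%:E <= (nsq x)%:E)%E.
Proof.
rewrite esum_coef lee_fin; case: ifP => [/andP[_ /asboolP]|_]; last exact: nsq_ge0.
exact.
Qed.

Definition compress n (A : H -> H) : K -> K := colop (coef n (A e0)).

Lemma compressE n A (h : K) p : compress n A h p = h (p.1, 0%N) * coef n (A e0) p.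
Proof. exact: (colopE (nsq_ge0 (A e0)) (esum_coef_le n _)). Qed.

Lemma compress_bcol n A : bcol (compress n A).
Proof. exact: (colop_bcol (nsq_ge0 (A e0)) (esum_coef_le n _)). Qed.

Lemma compress_delta n A t p :
  compress n A (delta0 t) p = (p.1 == t)%:R * coef n (A e0) p.
Proof. exact: (colop_delta (nsq_ge0 (A e0)) (esum_coef_le n _)). Qed.

Lemma compress_fcol n A : fcol level (compress n A).
Proof.
split; first exact: compress_bcol.
  move=> t m; rewrite /level => tm; rewrite compress_delta eqxx mul1r /coef /=.
  by case: eqP => //= <-; rewrite ltnNge tm.
move=> e e_gt0; exists n.+1 => t; rewrite /level => tn.
suff -> : compress n A (delta0 t) = 0 by rewrite nsq0 ltW.
apply: l2_ext => p; rewrite compress_delta; case: eqP => [pt|_]; last by rewrite mul0r.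
by rewrite mul1r /coef pt gtn_eqF.
Qed.

Lemma compress_linear n a A B :
  compress n (a *: A + B) = a *: compress n A + compress n B.
Proof.
apply/funext => h; apply: l2_ext => p.
rewrite [(_ + _) h]/(a *: compress n A h + compress n B h) l2D l2Z !compressE.
by rewrite [(a *: A + B) _]/(a *: A _ + B _) coef_linear mulrDr mulrCA.
Qed.

Lemma nsq_compress_sum n k (c : 'I_k -> R[i]) (A : 'I_k -> H -> H) t :
  nsq (\sum_j c j *: compress n (A j) (delta0 t)) =
  if (t.1 == n) && `[< bessel n t.2 >]
  then \sum_(m < n) sqmod (l2dot (\sum_j c j *: A j e0) (t.2 m)) else 0.
Proof.
have E p : (\sum_j c j *: compress n (A j) (delta0 t)) p =
    (p.1 == t)%:R * coef n (\sum_j c j *: A j e0) p.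
  rewrite l2_sum coef_sum mulr_sumr; apply: eq_bigr => j _.
  by rewrite l2Z compress_delta mulrCA.
apply: EFin_inj; rewrite -esum_coef (@nsq_one_block _ _ _ t).
  by apply: eq_esum => m _; rewrite E eqxx mul1r.
by move=> p /negPf pt; rewrite E pt mul0r.
Qed.

Lemma mxnorm_compress n (A : 'M[H -> H]_n) : (0 < n)%N ->
  (forall i j, bcol (A i j)) ->
  mxnorm (map_mx (compress n) A) = mxnorm A.
Proof.
move=> n0 Ab; have fb i j : bcol (map_mx (compress n) A i j).
  by rewrite mxE; exact: compress_bcol.
have fE t (c : 'I_n -> R[i]) i :
    \sum_j c j *: map_mx (compress n) A i j (delta0 t) =
    \sum_j c j *: compress n (A i j) (delta0 t).
  by apply: eq_bigr => j _; rewrite mxE.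
apply/eqP; rewrite eq_le; apply/andP; split.
  apply: mxnorm_bcol_le => //; first exact: mxnorm_bcol_ge0.
  move=> t c; apply: le_trans (mxnorm_bcol_ge tt c Ab).
  apply: ler_sum => i _; rewrite fE nsq_compress_sum.
  by case: ifP => [/andP[_ /asboolP]|_]; [exact|exact: nsq_ge0].
apply: mxnorm_bcol_le => //; first exact: mxnorm_bcol_ge0.
case=> c.
(* The n output vectors for the input c, extended by 0 beyond n. The family v that sees them
   entirely depends on c, which is why Y has a block for every v. *)
pose z k : l2 R I := if insub k is Some i then \sum_j c j *: A i j e0 else 0.
have [v vb vz] := gram_schmidt_bessel n z.
apply: le_trans (mxnorm_bcol_ge ((n, v) : T) c fb).
apply: ler_sum => i _; rewrite fE nsq_compress_sum /= eqxx.
have -> : `[< bessel n v >] by exact/asboolP.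
by have := vz i (ltn_ord i); rewrite /z valK => ->.
Qed.

Lemma bcol_almost_embeds : almost_completely_C_isomorphically_embeds
  (@bcol R unit) (fcol level).
Proof.
exists id, id, compress; split => //.
- move=> n n0; split; first by move=> A _; exact: compress_fcol.
  by move=> a A B _ _; exact: compress_linear.
- move=> n n0 x y xb yb.
  suff -> : map_mx (compress n) x - map_mx (compress n) y =
      map_mx (compress n) (x - y).
    rewrite mxnorm_compress ?lexx// => i j; rewrite !mxE -scaleN1r addrC.
    by have [_ _ bl _] := bcol_ospace R unit; exact: bl.
  apply/matrixP => i j; rewrite !mxE -scaleN1r addrC -compress_linear.
  by rewrite scaleN1r addrC.
Qed.

End Compressions.

(** * Failure of the complete embedding *)

Section GlidingHump.
Variables (R : realType) (T : Type) (lev : T -> nat).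
Variables (a : nat -> T -> R) (A : R).
Hypothesis a_le : forall i t, a i t <= A.
Hypothesis a_ge0 : forall i t, 0 <= a i t.
Hypothesis A_ge0 : 0 <= A.
Hypothesis sum_a : forall k t, \sum_(i < k) a i t <= (lev t)%:R * A.
Hypothesis a_vanish : forall i e, 0 < e ->
  exists N, forall t, (N <= lev t)%N -> a i t <= e.

(* A list of pairs (w, i) stands for the weighted sum of the functions a i. *)
Lemma weighted_sum_vanish (s : seq (R * nat)) :
  (forall p, p \in s -> 0 <= p.1) -> forall e, 0 < e ->
  exists N, forall t, (N <= lev t)%N -> \sum_(p <- s) p.1 * a p.2 t <= e.
Proof.
elim: s => [_ e e0|[w i] s IH ws e e0].
  by exists 0%N => t _; rewrite big_nil ltW.
have w0 : 0 <= w by apply: (ws (w, i)); rewrite mem_head.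
have ws' p : p \in s -> 0 <= p.1 by move=> ps; apply: ws; rewrite inE ps orbT.
have [|N NP] := IH ws' (e / 2); first by rewrite divr_gt0.
have [|M MP] := a_vanish i (e := e / 2 / (w + 1)).
  by rewrite !divr_gt0// ltr_wpDl.
exists (maxn N M) => t; rewrite geq_max => /andP[/NP Nt /MP].
rewrite big_cons /= ler_pdivlMr ?ltr_wpDl// => Mt.
by have := a_ge0 i t; nra.
Qed.

(* Each step adds the average of a 0, ..., a (m - 1), where m is so large that
   this average is at most d wherever the previous sum exceeds d. *)
Lemma gliding_hump (d : R) : 0 < d -> forall J : nat,
  exists s : seq (R * nat), [/\ forall p, p \in s -> 0 <= p.1,
    \sum_(p <- s) p.1 = J%:R &
    forall t, \sum_(p <- s) p.1 * a p.2 t <= A + J%:R * d].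
Proof.
move=> d0; elim=> [|J [s [s0 sJ sA]]].
  by exists [::]; split=> [//||t]; rewrite !big_nil// mul0r addr0.
have [N NP] := weighted_sum_vanish s0 d0.
pose m := (Num.truncn (N%:R * A / d)).+1.
have m0 : 0 < m%:R :> R by rewrite ltr0n.
have NAm : N%:R * A <= d * m%:R.
  by rewrite [leRHS]mulrC -ler_pdivrMr// ltW// truncnS_gt.
exists ([seq (m%:R^-1, i) | i <- iota 0 m] ++ s).
have iotaE : iota 0 m = index_iota 0 m by rewrite /index_iota subn0.
have avg t : \sum_(p <- [seq (m%:R^-1, i) | i <- iota 0 m]) p.1 * a p.2 t =
    (\sum_(i < m) a i t) / m%:R.
  by rewrite iotaE big_map -mulr_sumr big_mkord mulrC.
split.
- move=> p; rewrite mem_cat => /orP[/mapP[i _ ->]|/s0//].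
  by rewrite invr_ge0 ltW.
- rewrite big_cat iotaE big_map big_mkord.
  by rewrite sumr_const card_ord -[_ *+ m]mulr_natr mulVf ?gt_eqF// sJ -natr1 addrC.
- move=> t; rewrite big_cat /= avg.
  (* Below level N the new average is at most N A / m <= d; from level N on the old sum is at most d
     and the new average at most A. *)
  have [tN|Nt] := ltnP (lev t) N.
    have : (\sum_(i < m) a i t) / m%:R <= d.
      rewrite ler_pdivrMr//; apply: le_trans NAm; apply: le_trans (sum_a _ _) _.
      by rewrite ler_wpM2r// ler_nat ltnW.
    by have := sA t; rewrite -natr1; lra.
  have : (\sum_(i < m) a i t) / m%:R <= A.
    rewrite ler_pdivrMr// -[m in A * m%:R](card_ord m) mulr_natr -sumr_const.
    exact: ler_sum.
  have := NP t Nt; have : 0 <= J%:R * d by rewrite mulr_ge0// ltW.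
  rewrite -natr1; lra.
Qed.

(** J humps with d = 1 / J have total weight J and sum at most A + 1. Dividing the weights by A + 1
    leaves the total J / (A + 1), which exceeds |L| by the choice of J. *)
Lemma heavy_weights (L : R) : exists s : seq (R * nat),
  [/\ forall p, p \in s -> 0 <= p.1, L <= \sum_(p <- s) p.1 &
    forall t, \sum_(p <- s) p.1 * a p.2 t <= 1].
Proof.
have A1 : 0 < A + 1 by rewrite ltr_wpDl.
pose J := (Num.truncn (`|L| * (A + 1))).+1.
have J0 : 0 < J%:R :> R by rewrite ltr0n.
have [|s [s0 sJ sA]] := @gliding_hump (J%:R^-1) _ J; first by rewrite invr_gt0.
exists [seq (p.1 / (A + 1), p.2) | p <- s]; split.
- by move=> _ /mapP[p /s0 p0 ->]; rewrite divr_ge0 ?(ltW A1).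
- rewrite big_map /= -mulr_suml sJ ler_pdivlMr//.
  apply: (@le_trans _ _ (`|L| * (A + 1))); last by rewrite ltW// truncnS_gt.
  by rewrite ler_wpM2r ?ler_norm// ltW.
- move=> t; rewrite big_map /=.
  under eq_bigr do rewrite mulrAC.
  rewrite -mulr_suml ler_pdivrMr// mul1r.
  by have := sA t; rewrite mulfV// gt_eqF.
Qed.

End GlidingHump.

Lemma nsq_sum_delta (R : realType) (I : choiceType) n (c : 'I_n -> R[i])
    (p : 'I_n -> I) : injective p ->
  nsq (\sum_j c j *: delta R (p j)) = \sum_j sqmod (c j).
Proof.
move=> pI; apply: EFin_inj; rewrite nsqE -sumEFin.
under [RHS]eq_bigr => j _.
  rewrite -[sqmod _]mulr1 -(nsq_delta R (p j)) -nsqZ nsqE; over.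
rewrite -esum_sum; last by move=> i j _ _; rewrite lee_fin sqmod_ge0.
apply: eq_esum => q _; rewrite sumEFin l2_sum; congr (_%:E).
(* By injectivity of p, at most one of the vectors is nonzero at the coordinate q. *)
have [[j qj]|qp] := pselect (exists j, q = p j).
  have pE k : k != j -> (c k *: delta R (p k)) q = 0.
    by move=> kj; rewrite l2Z deltaE qj (inj_eq pI) eq_sym (negPf kj) mulr0.
  rewrite (bigD1 j) //= big1 => [|k kj]; last exact: pE.
  rewrite addr0 (bigD1 j) //= big1 ?addr0 // => k kj.
  by rewrite [X in sqmod X](pE k kj) sqmod0.
have pE k : (c k *: delta R (p k)) q = 0.
  rewrite l2Z deltaE; case: eqP => [qk|_]; last by rewrite mulr0.
  by case: qp; exists k.
rewrite big1 => [|k _]; last exact: pE.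
rewrite sqmod0 big1// => k _.
by rewrite [X in sqmod X]pE sqmod0.
Qed.

(** * Row and column estimates for a hypothetical embedding *)

Section NonEmbedding.
Variables (R : realType) (T : choiceType) (lev : T -> nat).
Let I : choiceType := (unit * nat)%type.
Local Notation H := (l2H R I).
Local Notation K := (l2H R (T * nat)%type).
Local Notation e0 := (delta R (tt, 0%N) : H).
Local Notation delta0 t := (delta R ((t, 0%N) : T * nat) : K).

Definition unit_column (i : nat) : H -> H := colop (delta R ((tt, i) : I)).

Lemma unit_column_esum i t :
  (\esum_(m in [set: nat]) (sqmod (delta R ((tt, i) : I) (t, m)))%:E <= 1%:E)%E.
Proof.
by apply: le_trans (esum_row_le _ _) _; rewrite -nsqE nsq_delta.
Qed.

Lemma unit_column_bcol i : bcol (unit_column i).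
Proof. exact: (colop_bcol ler01 (unit_column_esum i)). Qed.

Lemma unit_column_e0 i : unit_column i e0 = delta R ((tt, i) : I).
Proof.
apply: l2_ext => -[[] m].
by rewrite (colop_delta ler01 (unit_column_esum i)) eqxx mul1r.
Qed.

Lemma fcol_delta_nsq (A : K -> K) t : fcol lev A ->
  nsq (A (delta0 t)) = \sum_(m < lev t) sqmod (A (delta0 t) (t, m : nat)).
Proof.
move=> [[_ Ac] Av _]; apply: EFin_inj; rewrite -sumEFin (@nsq_one_block _ _ _ t).
  apply: esum_nat_fin => m; first by rewrite lee_fin sqmod_ge0.
  by move=> tm; rewrite Av// sqmod0.
by move=> [s m] /= st; rewrite Ac deltaE xpair_eqE (negPf st) mul0r.
Qed.

Section Embedding.
Variables (u : (H -> H) -> (K -> K)) (v : (K -> K) -> (H -> H)) (M N : R).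
Hypothesis u_fun : set_fun (@bcol R unit) (fcol lev) u.
Hypothesis u_lin : R_linear_on (@bcol R unit) u.
Hypothesis uK : {in @bcol R unit, cancel u v}.
Hypothesis u_bounded : forall n, (0 < n)%N -> forall x : 'M[H -> H]_n,
  mxspace (@bcol R unit) x -> mxnorm x <= 1 -> mxnorm (map_mx u x) <= M.
Hypothesis v_bounded : forall n, (0 < n)%N -> forall y : 'M[K -> K]_n,
  mxspace (u @` @bcol R unit) y -> mxnorm y <= 1 -> mxnorm (map_mx v y) <= N.

Let bcol0 : @bcol R unit 0. Proof. by case: (bcol_ospace R unit). Qed.

Let u0 : u 0 = 0.
Proof.
have := u_lin (-1) bcol0 bcol0.
by rewrite scaler0 addr0 rmorphN scaleN1r addNr.
Qed.

Let uZ (a : R) A : bcol A -> u (a%:C *: A) = a%:C *: u A.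
Proof. by move=> bA; have := u_lin a bA bcol0; rewrite u0 !addr0. Qed.

Let bcolZ (a : R[i]) (A : H -> H) : bcol A -> bcol (a *: A).
Proof.
move=> bA; have [_ _ bl _] := bcol_ospace R unit.
by have := bl a _ _ bA bcol0; rewrite addr0.
Qed.

Let y i := u (unit_column i).

Let y_fcol i : fcol lev (y i).
Proof. exact/u_fun/unit_column_bcol. Qed.

(** The row of the first n unit columns, padded with zero rows to a square matrix, maps c to a
    vector of norm |c|, so its image under u has norm at most M. The scalars c may be complex
    although u is only R-linear: they enter as input vectors, after u has been applied. *)
Lemma row_bound n t (c : 'I_n -> R[i]) :
  nsq (\sum_j c j *: y j (delta0 t)) <= M ^+ 2 * \sum_j sqmod (c j).
Proof.
case: n c => [|n] c; first by rewrite !big_ord0 nsq0 mulr0.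
pose x : 'M[H -> H]_n.+1 :=
  \matrix_(i, j) if i == ord0 then unit_column j else 0.
have xb : mxspace (@bcol R unit) x.
  by move=> i j; rewrite mxE; case: ifP => _ //; exact: unit_column_bcol.
have uxb i j : bcol (map_mx u x i j).
  by rewrite mxE; have [] := u_fun (xb i j).
have x1 : mxnorm x <= 1.
  apply: mxnorm_bcol_le => // -[] d; rewrite expr1n mul1r /sumnsq.
  rewrite big_ord_recl [X in _ + X]big1 ?addr0 => [|i _]; last first.
    by rewrite big1 ?nsq0// => j _; rewrite mxE /= scaler0.
  under eq_bigr do rewrite mxE eqxx unit_column_e0.
  by rewrite nsq_sum_delta// => j k [] /ord_inj.
have uxM := u_bounded (ltn0Sn n) xb x1.
apply: (@le_trans _ _ (mxnorm (map_mx u x) ^+ 2 * \sum_j sqmod (c j))); last first.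
  apply: ler_wpM2r; first by apply: sumr_ge0 => j _; exact: sqmod_ge0.
  by apply: lerXn2r => //; rewrite nnegrE ?(le_trans _ uxM)// mxnorm_bcol_ge0.
apply: le_trans (mxnorm_bcol_ge t c uxb).
rewrite /sumnsq [leRHS]big_ord_recl /=.
under [X in _ <= nsq X + _]eq_bigr do rewrite !mxE eqxx.
by rewrite lerDl; apply: sumr_ge0 => i _; exact: nsq_ge0.
Qed.

(* The row with entries y j, applied to the conjugates of the entries. *)
Lemma entry_bound n t m :
  \sum_(j < n) sqmod (y j (delta0 t) (t, m)) <= M ^+ 2.
Proof.
set s := \sum_(j < n) _.
have s_ge0 : 0 <= s by apply: sumr_ge0 => j _; exact: sqmod_ge0.
have := row_bound t (fun j : 'I_n => Num.conj (y j (delta0 t) (t, m))).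
under [X in _ <= _ * X]eq_bigr do rewrite sqmod_conj.
rewrite -/s; set z := \sum_j _ => zs.
have := le_trans (sqmod_le_nsq z (t, m)) zs.
have -> : z (t, m) = s%:C.
  rewrite l2_sum rmorph_sum; apply: eq_bigr => j _.
  by rewrite l2Z mulrC mul_conj_sqmod.
rewrite sqmod_real; have [->|s0] := eqVneq s 0; first by rewrite sqr_ge0.
by rewrite expr2 ler_pM2r// lt_neqAle eq_sym s0.
Qed.

Lemma column_bound L : exists2 s : seq (R * nat),
  L <= \sum_(p <- s) p.1 /\ (forall p, p \in s -> 0 <= p.1) &
  forall t, \sum_(p <- s) p.1 * nsq (y p.2 (delta0 t)) <= 1.
Proof.
have [] := @heavy_weights R T lev (fun i t => nsq (y i (delta0 t))) (M ^+ 2)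
  _ _ _ _ _ L.
- move=> i t.
  (* A single column is the row of length i + 1 tested on its last basis vector. *)
  have := row_bound t (fun j : 'I_i.+1 => (j == ord_max)%:R).
  rewrite (bigD1 ord_max)//= big1 ?addr0 => [|j /negPf ->]; last by rewrite scale0r.
  rewrite eqxx scale1r (bigD1 ord_max)//=.
  rewrite big1 ?addr0 => [|j /negPf ->]; last by rewrite sqmod0.
  by rewrite eqxx -[1%:R]/(1%:C) sqmod_real expr1n mulr1.
- by move=> i t; exact: nsq_ge0.
- exact: sqr_ge0.
(* After exchanging the sums, each of the [lev t] coordinates of the block contributes at most M^2
   by [entry_bound]. *)
- move=> k t; under eq_bigr do rewrite fcol_delta_nsq//.
  rewrite exchange_big /= mulr_natl -[X in _ *+ X](card_ord (lev t)) -sumr_const.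
  by apply: ler_sum => m _; exact: entry_bound.
- by move=> i e e_gt0; have [_ _ +] := y_fcol i; exact.
- by move=> s [s0 sL s1]; exists s.
Qed.

Lemma no_embedding : False.
Proof.
(* A total weight above N^2 will contradict the bound N on v; being positive, it also makes s
   nonempty and so provides the column index [o]. *)
have [s [sL s0] s1] := column_bound (N ^+ 2 + 1).
have n_gt0 : (0 < size s)%N.
  case: s sL {s0 s1} => //; rewrite big_nil leNgt => /negP[].
  by rewrite ltr_wpDl// sqr_ge0.
set n := size s in n_gt0; pose o := Ordinal n_gt0.
pose p (i : 'I_n) := nth (0, 0%N) s i.
have p0 i : 0 <= (p i).1 by apply/s0/mem_nth.
have sumE (F : R * nat -> R) : \sum_(q <- s) F q = \sum_i F (p i).
  by rewrite (big_nth (0, 0%N)) big_mkord.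
(* The weights enter through real square roots, which the R-linear u carries out of its argument. *)
pose x : 'M[H -> H]_n :=
  \matrix_(i, j) if j == o then (Num.sqrt (p i).1)%:C *: unit_column (p i).2 else 0.
have xb : mxspace (@bcol R unit) x.
  by move=> i j; rewrite mxE; case: ifP => _ //; apply/bcolZ/unit_column_bcol.
have uxb i j : bcol (map_mx u x i j).
  by rewrite mxE; have [] := u_fun (xb i j).
have colE (d : 'I_n -> R[i]) (Z : lmodType R[i]) (F : 'I_n -> Z) :
    (forall j, j != o -> F j = 0) -> \sum_j d j *: F j = d o *: F o.
  move=> F0; rewrite (bigD1 o)//= big1 ?addr0// => j /F0 ->; exact: scaler0.
have ux1 : mxnorm (map_mx u x) <= 1.
  apply: mxnorm_bcol_le => // t d; rewrite expr1n mul1r /sumnsq.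
  apply: (@le_trans _ _ (\sum_i sqmod (d o) * ((p i).1 * nsq (y (p i).2 (delta0 t))))).
    apply: ler_sum => i _; rewrite colE => [|j /negPf jo]; last by rewrite !mxE jo u0.
    rewrite !mxE eqxx uZ; last exact: unit_column_bcol.
    by rewrite [(_ *: u _) _]/(_ *: y _ _) nsqZ nsqZ sqmod_real sqr_sqrtr.
  rewrite -mulr_sumr -(sumE (fun q => q.1 * nsq (y q.2 (delta0 t)))).
  apply: (@le_trans _ _ (sqmod (d o))); first by rewrite ler_piMr ?sqmod_ge0.
  by rewrite (bigD1 o)//= lerDl sumr_ge0// => j _; exact: sqmod_ge0.
have vux : map_mx v (map_mx u x) = x.
  by apply/matrixP => i j; rewrite !mxE uK//; apply/mem_set; have := xb i j; rewrite mxE.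
have ux_img : mxspace (u @` @bcol R unit) (map_mx u x).
  by move=> i j; exists (x i j); [exact: xb|rewrite [RHS]mxE].
have := v_bounded n_gt0 ux_img ux1; rewrite vux => xN.
(* Evaluated at [e0] in position [o], x gives multiples of basis vectors with squared norms the
   weights. They lie in different components, so indices repeated in s do no harm. *)
have := mxnorm_bcol_ge tt (fun j => (j == o)%:R) xb.
rewrite [X in _ <= _ * X](bigD1 o)//=.
rewrite big1 ?addr0 => [|j /negPf ->]; last by rewrite sqmod0.
rewrite -[X in sqmod X]/(1%:C) sqmod_real expr1n mulr1 /sumnsq.
have -> : \sum_i nsq (\sum_j ((j == o)%:R : R[i]) *: x i j e0) = \sum_(q <- s) q.1.
  rewrite sumE; apply: eq_bigr => i _.
  rewrite colE => [|j /negPf jo]; last by rewrite mxE jo.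
  rewrite mxE eqxx scale1r [(_ *: unit_column _) _]/(_ *: unit_column _ _).
  rewrite unit_column_e0.
  by rewrite nsqZr nsq_delta mulr1 sqr_sqrtr.
move=> /(le_trans sL); apply/negP; rewrite -ltNge.
apply: (@le_lt_trans _ _ (N ^+ 2)); last by rewrite ltrDl.
by apply: lerXn2r => //; rewrite nnegrE ?(le_trans _ xN)// mxnorm_bcol_ge0.
Qed.

End Embedding.

Lemma bcol_not_embeds :
  ~ completely_R_isomorphically_embeds (@bcol R unit) (fcol lev).
Proof.
move=> [u [v [u_fun u_lin uK [M uM] [N vN]]]].
apply: (@no_embedding u v M N) => //.
  by move=> n n0 x xb x1; have /opnormP := uM n n0; exact.
by move=> n n0 z zb z1; have /opnormP := vN n n0; exact.
Qed.

End NonEmbedding.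

Theorem theorem4p2 (R : realType) :
  exists (H K : hilbertType R) (X : set (H -> H)) (Y : set (K -> K)),
    [/\ operator_space X, operator_space Y,
        almost_completely_C_isomorphically_embeds X Y &
        ~ completely_R_isomorphically_embeds X Y].
Proof.
exists (l2H R (unit * nat)%type).
exists (l2H R (nat * (nat -> l2 R (unit * nat)%type) * nat)%type).
exists (@bcol R unit), (fcol (@level R)); split.
- exact: bcol_ospace.
- exact: fcol_ospace.
- exact: bcol_almost_embeds.
- exact: bcol_not_embeds.
Qed.
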